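(* Let $d\ge 2$ and let $A_0B_0$ and $A_1B_1$ be two unit segments in $\mathbb{R}^d$. There exists a continuous rigid motion transforming $A_0B_0$ into $A_1B_1$ (taking $A_0$ to $A_1$ and $B_0$ to $B_1$) whose total trajectory length satisfies $$L(A_0B_0,A_1B_1)=|A_0A_1|+|B_0B_1|$$ if and only if both $$\left(\overrightarrow{A_0A_1}\cdot \overrightarrow{A_0B_0}\right)\left(\overrightarrow{A_0A_1}\cdot \overrightarrow{A_1B_1}\right)\ge 0$$ and $$\left(\overrightarrow{B_0B_1}\cdot \overrightarrow{A_0B_0}\right)\left(\overrightarrow{B_0B_1}\cdot \overrightarrow{A_1B_1}\right)\ge 0 .$$
   Context: A continuous rigid motion transforming the unit segment $A_0B_0$ into the unit segment $A_1B_1$ is described by the trajectories of its endpoints: continuous curves $A,B:[0,1]\to\mathbb{R}^d$ with $A(0)=A_0$, $B(0)=B_0$, $A(1)=A_1$, $B(1)=B_1$ and $|B(t)-A(t)|=1$ for all $t\in[0,1]$. For such a motion, $L(A_0B_0,A_1B_1):=L(A_0)+L(B_0)$ denotes the sum of the lengths of the two curves $A(t)$ and $B(t)$, $t\in[0,1]$ (so this number depends on the motion). Only motions with $L(A_0B_0,A_1B_1)<\infty$ are considered; after a reparametrization, which does not change lengths, $A(t)$ and $B(t)$ are assumed to be Lipschitz. Here $\cdot$ is the Euclidean inner product and $|XY|$ is the Euclidean distance between the points $X$ and $Y$. *)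

(* Defs.v *)
From HB Require Import structures.
From mathcomp Require Import all_boot all_order all_algebra.
From mathcomp Require Import all_classical all_reals all_analysis.

Set Implicit Arguments.
Unset Strict Implicit.
Unset Printing Implicit Defensive.

Import Order.TTheory GRing.Theory Num.Theory.
Import numFieldNormedType.Exports.

Local Open Scope classical_set_scope.
Local Open Scope ring_scope.

(* Points and vectors of R^d are row vectors 'rV[R]_d. The library norm on
   matrices is the sup norm, so the Euclidean structure is defined here; the
   library topology, used for continuity, is the Euclidean one. *)
Definition dotp (R : realType) (d : nat) (u v : 'rV[R]_d) : R :=
  \sum_(i < d) u 0 i * v 0 i.

Definition eucl_norm (R : realType) (d : nat) (u : 'rV[R]_d) : R :=
  Num.sqrt (dotp u u).

Definition eucl_dist (R : realType) (d : nat) (X Y : 'rV[R]_d) : R :=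
  eucl_norm (Y - X).

(* Vector-valued counterpart of [variation] and [total_variation]: as there,
   [itv_partition a b s] means that a :: s increases strictly from a to b. *)
Definition polygon_length (R : realType) (d : nat) (a b : R)
    (g : R -> 'rV[R]_d) (s : seq R) : R :=
  let F := g \o nth b (a :: s) in
  \sum_(0 <= n < size s) eucl_dist (F n) (F n.+1).

Definition curve_length (R : realType) (d : nat) (a b : R)
    (g : R -> 'rV[R]_d) : \bar R :=
  ereal_sup [set (polygon_length a b g s)%:E | s in itv_partition a b].

(* Curves on [0, 1] are total functions on R of which only the restriction to
   [0, 1] is constrained (and only that restriction enters [total_length]). *)
Record rigid_motion (R : realType) (d : nat) (A0 B0 A1 B1 : 'rV[R]_d)
    (A B : R -> 'rV[R]_d) : Prop := RigidMotion {
  motion_contA : {within `[0, 1], continuous A};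
  motion_contB : {within `[0, 1], continuous B};
  motion_startA : A 0 = A0;
  motion_startB : B 0 = B0;
  motion_endA : A 1 = A1;
  motion_endB : B 1 = B1;
  motion_rigid : forall t : R, 0 <= t <= 1 -> eucl_dist (A t) (B t) = 1
}.

Definition total_length (R : realType) (d : nat) (A B : R -> 'rV[R]_d) :
    \bar R :=
  (curve_length 0 1 A + curve_length 0 1 B)%E.

(* Main.v *)
(* The total length equals |A0A1| + |B0B1| exactly when A and B stay on the
   segments A0A1 and B0B1 and move monotonically. Put a = A0A1, b = B0B1 and
   u = AB. The distance from B to the line A0A1 is 1 exactly when a . u = 0,
   and it is a convex function of the position of B on B0B1; so if it is below 1
   at both ends, a . u cannot vanish, hence cannot change sign. Conversely
   |u0| = |u1| = 1 forces a . (u0 + u1) = b . (u0 + u1), so under the two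
   inequalities the four products share a weak sign. Exchanging A and B we may
   take it nonnegative, and then letting B move uniformly, solving |AB| = 1 for
   the position of A on its line gives a nondecreasing motion. *)
Require Import Defs.
From mathcomp Require Import all_boot all_order all_algebra.
From mathcomp Require Import all_classical all_reals all_analysis.
From mathcomp Require Import ring lra.

Import Order.TTheory GRing.Theory Num.Theory.
Import numFieldNormedType.Exports.
Local Open Scope classical_set_scope.
Local Open Scope ring_scope.

(** * Euclidean inner product and norm *)

Lemma dotpC {R : realType} {d} (u v : 'rV[R]_d) : dotp u v = dotp v u.
Proof. by apply: eq_bigr => i _; rewrite mulrC. Qed.

Lemma dotpDr {R : realType} {d} (u v w : 'rV[R]_d) :
  dotp u (v + w) = dotp u v + dotp u w.
Proof. by rewrite /dotp -big_split/=; apply: eq_bigr => i _; rewrite mxE mulrDr. Qed.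

Lemma dotpZr {R : realType} {d} k (u v : 'rV[R]_d) :
  dotp u (k *: v) = k * dotp u v.
Proof. by rewrite /dotp mulr_sumr; apply: eq_bigr => i _; rewrite mxE mulrCA. Qed.

Lemma dotpDl {R : realType} {d} (u v w : 'rV[R]_d) :
  dotp (u + v) w = dotp u w + dotp v w.
Proof. by rewrite dotpC dotpDr !(dotpC w). Qed.

Lemma dotpZl {R : realType} {d} k (u v : 'rV[R]_d) :
  dotp (k *: u) v = k * dotp u v.
Proof. by rewrite dotpC dotpZr dotpC. Qed.

Lemma dotpNr {R : realType} {d} (u v : 'rV[R]_d) : dotp u (- v) = - dotp u v.
Proof. by rewrite -scaleN1r dotpZr mulN1r. Qed.

Lemma dotpNl {R : realType} {d} (u v : 'rV[R]_d) : dotp (- u) v = - dotp u v.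
Proof. by rewrite dotpC dotpNr dotpC. Qed.

Lemma dotp0l {R : realType} {d} (u : 'rV[R]_d) : dotp 0 u = 0.
Proof. by rewrite -(scale0r u) dotpZl mul0r. Qed.

Definition dotpE := (@dotpDr, @dotpDl, @dotpNr, @dotpNl, @dotpZr, @dotpZl).

Lemma dotp_ge0 {R : realType} {d} (u : 'rV[R]_d) : 0 <= dotp u u.
Proof. by apply: sumr_ge0 => i _; rewrite -expr2 sqr_ge0. Qed.

Lemma dotp_eq0 {R : realType} {d} (u : 'rV[R]_d) : (dotp u u == 0) = (u == 0).
Proof.
apply/eqP/eqP => [u0|->]; last by rewrite /dotp big1// => i _; rewrite mxE mul0r.
apply/rowP => i; rewrite mxE; apply/eqP; rewrite -[_ == 0]orbb -mulf_eq0.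
apply/eqP; move: i (erefl true); apply: psumr_eq0P => // i _.
by rewrite -expr2 sqr_ge0.
Qed.

Lemma eucl_norm_ge0 {R : realType} {d} (u : 'rV[R]_d) : 0 <= eucl_norm u.
Proof. exact: sqrtr_ge0. Qed.

Lemma sqr_eucl_norm {R : realType} {d} (u : 'rV[R]_d) :
  eucl_norm u ^+ 2 = dotp u u.
Proof. by rewrite sqr_sqrtr// dotp_ge0. Qed.

Lemma eucl_normZ {R : realType} {d} k (u : 'rV[R]_d) :
  eucl_norm (k *: u) = `|k| * eucl_norm u.
Proof.
by rewrite /eucl_norm dotpZl dotpZr mulrA -expr2 sqrtrM ?sqr_ge0// sqrtr_sqr.
Qed.

Lemma eucl_normN {R : realType} {d} (u : 'rV[R]_d) :
  eucl_norm (- u) = eucl_norm u.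
Proof. by rewrite /eucl_norm dotpNl dotpNr opprK. Qed.

Lemma eucl_distC {R : realType} {d} (X Y : 'rV[R]_d) :
  eucl_dist X Y = eucl_dist Y X.
Proof. by rewrite /eucl_dist -eucl_normN opprB. Qed.

Lemma eucl_norm_eq1 {R : realType} {d} (u : 'rV[R]_d) :
  eucl_norm u = 1 <-> dotp u u = 1.
Proof.
split=> [u1|u1]; first by rewrite -sqr_eucl_norm u1 expr1n.
by rewrite /eucl_norm u1 sqrtr1.
Qed.

(** * Distance to a line and unit vectors *)

(* |a|^2 times the squared distance from [w] to the line spanned by [a]. *)
Definition gram {R : realType} {d} (a w : 'rV[R]_d) : R :=
  dotp a a * dotp w w - dotp a w ^+ 2.

Lemma gram_ge0 {R : realType} {d} (a w : 'rV[R]_d) : 0 <= gram a w.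
Proof.
have [->|a0] := eqVneq a 0.
  by rewrite /gram !dotp0l; lra.
have aa : 0 < dotp a a by rewrite lt_def dotp_eq0 a0 dotp_ge0.
rewrite -(pmulr_rge0 _ aa).
(* This vector is $|a|^2$ times the component of [w] orthogonal to [a]; its squared norm is $|a|^2$
   times [gram a w]. *)
have := dotp_ge0 (dotp a a *: w - dotp a w *: a).
by rewrite !dotpE (dotpC w a) /gram; congr (_ <= _); ring.
Qed.

Lemma gram_shift {R : realType} {d} s (a w : 'rV[R]_d) :
  gram a (w - s *: a) = gram a w.
Proof. by rewrite /gram !dotpE (dotpC w a); ring. Qed.

(** Both sides are quadratic in [r] with leading coefficient [- gram a b]. They agree at [r = 0],
    and also at [r = 1], where [u0 + b = u1 + a] and the shift by [a] leaves [gram] unchanged. *)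
Lemma gram_segment {R : realType} {d} r (a b u0 u1 : 'rV[R]_d) :
    dotp u0 u0 = 1 -> dotp u1 u1 = 1 -> u1 = u0 + b - a ->
  dotp a a - gram a (u0 + r *: b) =
  (1 - r) * dotp a u0 ^+ 2 + r * dotp a u1 ^+ 2 + r * (1 - r) * gram a b.
Proof.
move=> u01 + u1E; rewrite u1E /gram !dotpE u01.
rewrite (dotpC u0 a) (dotpC b a) (dotpC u0 b).
set x := dotp a a; set y := dotp b b; set z := dotp a b.
set p := dotp a u0; set q := dotp b u0 => h.
have {h}-> : q = p + z - x / 2 - y / 2 by lra.
by field.
Qed.

(** $0 = |u_1|^2 - |u_0|^2 = (u_1 - u_0)\cdot(u_1 + u_0)$, and $u_1 - u_0 = b - a$. *)
Lemma sum_dotp_ends {R : realType} {d} (a b u0 u1 : 'rV[R]_d) :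
    dotp u0 u0 = 1 -> dotp u1 u1 = 1 -> u1 = u0 + b - a ->
  dotp a u0 + dotp a u1 = dotp b u0 + dotp b u1.
Proof.
move=> u01 + u1E; rewrite u1E !dotpE u01.
rewrite (dotpC u0 a) (dotpC b a) (dotpC u0 b); lra.
Qed.

(** * Curves as short as their chords *)

Lemma triangle_eq {R : realType} {d} (x y : 'rV[R]_d) :
    eucl_norm x + eucl_norm y <= eucl_norm (x + y) ->
  exists2 s, 0 <= s <= 1 & x = s *: (x + y).
Proof.
set m := eucl_norm x; set n := eucl_norm y => le.
have m0 : 0 <= m := eucl_norm_ge0 x.
have n0 : 0 <= n := eucl_norm_ge0 y.
have xx : dotp x x = m ^+ 2 by rewrite sqr_eucl_norm.
have yy : dotp y y = n ^+ 2 by rewrite sqr_eucl_norm.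
have xy : m * n <= dotp x y.
  have : (m + n) ^+ 2 <= eucl_norm (x + y) ^+ 2.
    by rewrite lerXn2r// nnegrE ?addr_ge0// eucl_norm_ge0.
  rewrite sqr_eucl_norm !dotpE xx yy (dotpC y x); lra.
(* The squared norm of $nx - my$ is $2mn(mn - x\cdot y)$, which [xy] makes nonpositive. *)
have nx : n *: x = m *: y.
  apply/eqP; rewrite -subr_eq0 -dotp_eq0 eq_le dotp_ge0 andbT.
  rewrite !dotpE xx yy (dotpC y x).
  have := mulr_ge0 m0 n0; nra.
have [mn0|mn0] := eqVneq (m + n) 0.
  have /eqP : m = 0 by lra.
  rewrite -sqrf_eq0 -xx dotp_eq0 => /eqP x0.
  by exists 0; rewrite ?lexx ?ler01// scale0r.
have mn : 0 < m + n by rewrite lt_def mn0 addr_ge0.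
exists (m / (m + n)).
  by rewrite divr_ge0 ?(ltW mn)//= ler_pdivrMr// mul1r lerDl.
apply: (scalerI mn0); rewrite scalerA mulrC divfK//.
by rewrite scalerDr scalerDl nx.
Qed.

Lemma curve_length_ge_polygon {R : realType} {d} (g : R -> 'rV[R]_d) s :
  itv_partition 0 1 s -> ((polygon_length 0 1 g s)%:E <= curve_length 0 1 g)%E.
Proof. by move=> ps; apply: ereal_sup_ubound; exists s. Qed.

Lemma curve_length_ge {R : realType} {d} (g : R -> 'rV[R]_d) :
  ((eucl_dist (g 0) (g 1))%:E <= curve_length 0 1 g)%E.
Proof.
have := curve_length_ge_polygon g [:: 1] (itv_partition1 ltr01).
by rewrite /polygon_length/= big_nat1.
Qed.

(** For interior [t], the polygon through times 0, [t], 1 is no longer than the chord, so the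
    triangle inequality is an equality. *)
Lemma shortest_curve_segment {R : realType} {d} (g : R -> 'rV[R]_d) t :
    (curve_length 0 1 g <= (eucl_dist (g 0%R) (g 1%R))%:E)%E -> 0 <= t <= 1 ->
  exists2 s, 0 <= s <= 1 & g t = g 0 + s *: (g 1 - g 0).
Proof.
move=> gle /andP[]; rewrite le_eqVlt => /predU1P[<- _|t0].
  by exists 0; rewrite ?lexx ?ler01// scale0r addr0.
rewrite le_eqVlt => /predU1P[->|t1].
  by exists 1; rewrite ?lexx ?ler01// scale1r addrC subrK.
have pt : itv_partition 0 1 [:: t; 1] by split; rewrite /= ?t0 ?t1.
have := le_trans (curve_length_ge_polygon g _ pt) gle.
rewrite lee_fin /polygon_length/= big_nat_recl// big_nat1/= /eucl_dist.
have -> : g 1 - g 0 = (g t - g 0) + (g 1 - g t) by rewrite [RHS]addrC addrA subrK.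
by move=> /triangle_eq[s s01 sE]; exists s; rewrite -?sE 1?addrC ?subrK.
Qed.

(** Every inscribed polygon has the same length: the variation of [f] times the norm of [v], and the
    variation of a nondecreasing [f] is [f 1 - f 0]. *)
Lemma curve_length_segment {R : realType} {d} (P v : 'rV[R]_d) (f : R -> R) :
    {in `[0, 1] &, {homo f : x y / x <= y}} -> f 0 = 0 -> f 1 = 1 ->
  curve_length 0 1 (fun t => P + f t *: v) = (eucl_norm v)%:E.
Proof.
move=> ndf f0 f1.
have polyE s : itv_partition 0 1 s ->
    polygon_length 0 1 (fun t => P + f t *: v) s = eucl_norm v.
  move=> ps; transitivity (variation 0 1 f s * eucl_norm v); last first.
    by rewrite (nondecreasing_variation ndf ps) f0 f1 subr0 mul1r.
  rewrite /polygon_length /variation mulr_suml; apply: eq_bigr => n _ /=.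
  by rewrite -eucl_normZ /eucl_dist opprD addrACA subrr add0r scalerBl.
apply/eqP; rewrite eq_le; apply/andP; split.
  by apply: ge_ereal_sup => _ [s ps <-]; rewrite polyE.
have p1 : itv_partition (0 : R) 1 [:: 1] by exact/itv_partition1/ltr01.
by rewrite -(polyE _ p1); exact: curve_length_ge_polygon.
Qed.

(** * Necessity of the sign conditions *)

Lemma within_continuous_dotp {R : realType} {d} (D : set R) (a : 'rV[R]_d)
    (u : R -> 'rV[R]_d) :
  {within D, continuous u} -> {within D, continuous (fun t => dotp a (u t))}.
Proof.
move=> cu; apply: continuous_big => [|i _]; first exact: add_continuous.
move=> x; apply: cvgM; first exact: cvg_cst.
apply: (@continuous_comp (subspace D) _ _ u (fun v : 'rV[R]_d => v 0 i)); first exact: cu.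
exact: coord_continuous.
Qed.

Lemma dotp_ends_ge0 {R : realType} {d} (a b : 'rV[R]_d) (u : R -> 'rV[R]_d) :
    {within `[0, 1], continuous u} -> u 1 = u 0 + b - a ->
    (forall t, 0 <= t <= 1 -> dotp (u t) (u t) = 1) ->
    (forall t, 0 <= t <= 1 -> exists s, exists2 r, 0 <= r <= 1 &
        u t = u 0 + r *: b - s *: a) ->
  0 <= dotp a (u 0) * dotp a (u 1).
Proof.
move=> cu u1E uu useg; rewrite leNgt; apply/negP => lt0.
have I0 : 0 <= (0 : R) <= 1 by rewrite lexx ler01.
have I1 : 0 <= (1 : R) <= 1 by rewrite lexx ler01.
have zb : Num.min (dotp a (u 0)) (dotp a (u 1)) <= 0 <=
          Num.max (dotp a (u 0)) (dotp a (u 1)).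
  by rewrite ge_min le_max; nra.
have [t + zt] := IVT ler01 (within_continuous_dotp _ a _ cu) zb.
rewrite in_itv/= => t01; have [s [r /andP[r0 r1] utE]] := useg _ t01.
(* At a zero of [dotp a (u t)] the left side of [gram_segment] vanishes, whatever [s] is; its right
   side is positive because both end products are nonzero. *)
have := gram_shift s a (u 0 + r *: b); rewrite -utE {1}/gram zt uu// => gE.
have := gram_segment r _ _ _ _ (uu _ I0) (uu _ I1) u1E.
rewrite -gE.
have g0 := mulr_ge0 (mulr_ge0 r0 (etrans (subr_ge0 _ _) r1)) (gram_ge0 a b).
have p0 : 0 < dotp a (u 0) ^+ 2.
  by rewrite exprn_even_gt0//=; apply/eqP => e; rewrite e mul0r ltxx in lt0.
have p1 : 0 < dotp a (u 1) ^+ 2.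
  by rewrite exprn_even_gt0//=; apply/eqP => e; rewrite e mulr0 ltxx in lt0.
have r1' : 0 <= 1 - r by rewrite subr_ge0.
suff : 0 < (1 - r) * dotp a (u 0) ^+ 2 + r * dotp a (u 1) ^+ 2 by lra.
have [rp|rn] := ltrP 0 r.
  by apply: ltr_wpDl; [rewrite mulr_ge0// ltW|exact: mulr_gt0].
have -> : r = 0 by apply/eqP; rewrite eq_le r0 rn.
by rewrite subr0 mul1r mul0r addr0.
Qed.

(** * Construction of a shortest motion *)

(* The unit condition is a quadratic equation for f t; the root chosen is the
   one with [dotp a u] nonnegative. It is convex in t, and it is nonnegative
   with f 0 = 0, hence nondecreasing. *)
Lemma monotone_parameter {R : realType} {d} (a b u0 u1 : 'rV[R]_d) :
    dotp u0 u0 = 1 -> dotp u1 u1 = 1 -> u1 = u0 + b - a -> a != 0 ->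
    0 <= dotp a u0 -> 0 <= dotp a u1 -> 0 <= dotp b u0 ->
  exists f : R -> R, [/\ continuous f,
    {in `[0, 1] &, {homo f : x y / x <= y}}, f 0 = 0, f 1 = 1 &
    forall t, 0 <= t <= 1 ->
      dotp (u0 + t *: b - f t *: a) (u0 + t *: b - f t *: a) = 1].
Proof.
move=> u0u0 u1u1 u1E a0 p0 p1 q0.
have x0 : 0 < dotp a a by rewrite lt_def dotp_eq0 a0 dotp_ge0.
have xN0 : dotp a a != 0 by rewrite gt_eqF.
have c0 := gram_ge0 a b.
(* A quarter of the discriminant of the quadratic for [f t], in the form given by [gram_segment]. *)
pose k t := (1 - t) * dotp a u0 ^+ 2 + t * dotp a u1 ^+ 2
            + t * (1 - t) * gram a b.
have kE t : dotp a a - gram a (u0 + t *: b) = k t by exact: gram_segment.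
pose f t := (dotp a u0 + t * dotp a b - Num.sqrt (k t)) / dotp a a.
have k0 t : 0 <= t <= 1 -> 0 <= k t.
  move=> /andP[t0 t1]; have t1' : 0 <= 1 - t by rewrite subr_ge0.
  by rewrite /k !addr_ge0// !mulr_ge0// sqr_ge0.
have f0 : f 0 = 0.
  by rewrite /f /k !mul0r subr0 mul1r !addr0 sqrtr_sqr ger0_norm// subrr mul0r.
have f1 : f 1 = 1.
  rewrite /f /k subrr !mul0r mulr0 mul0r !mul1r addr0 add0r sqrtr_sqr ger0_norm//.
  rewrite u1E !dotpE; have -> : forall x y z : R, x + y - (x + y - z) = z.
    by move=> x y z; ring.
  by rewrite divff.
have f_ge0 t : 0 <= t <= 1 -> 0 <= f t.
  move=> /andP[t0 t1]; rewrite /f divr_ge0 ?(ltW x0)// subr_ge0.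
  have w0 : 0 <= dotp a u0 + t * dotp a b.
    have : dotp a u1 = dotp a u0 + dotp a b - dotp a a by rewrite u1E !dotpE.
    nra.
  (* With $w = u_0 + tb$, the claim is $k(t) \le (a\cdot w)^2$. The difference is $|a|^2(|w|^2 - 1)
     = |a|^2(2t\, b\cdot u_0 + t^2|b|^2)$, so the sign of $b\cdot u_0$ enters here. *)
  rewrite -[leRHS]ger0_norm// -sqrtr_sqr ler_wsqrtr// -kE /gram.
  rewrite !dotpE u0u0 (dotpC u0 b).
  have := mulr_ge0 (ltW x0) (mulr_ge0 t0 q0).
  have := mulr_ge0 (ltW x0) (mulr_ge0 t0 (mulr_ge0 t0 (dotp_ge0 b))).
  lra.
have f_conv l t : 0 <= l <= 1 -> 0 <= t <= 1 -> f (l * t) <= l * f t.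
  move=> /andP[l0 l1] t01; rewrite /f mulrA ler_pM2r ?invr_gt0//.
  have := sqr_sqrtr (k0 _ t01); have := sqrtr_ge0 (k t).
  set r := Num.sqrt (k t) => r0 rE.
  have l1' : 0 <= 1 - l by rewrite subr_ge0.
  (* Convexity of [f] on $[0,t]$ reduces to concavity of $\sqrt{k}$, whose value at 0 is
     [dotp a u0]. *)
  suff : (1 - l) * dotp a u0 + l * r <= Num.sqrt (k (l * t)) by lra.
  have v0 : 0 <= (1 - l) * dotp a u0 + l * r by rewrite addr_ge0// mulr_ge0.
  rewrite -[leLHS]ger0_norm// -sqrtr_sqr ler_wsqrtr//.
  rewrite -subr_ge0.
  have -> : k (l * t) - ((1 - l) * dotp a u0 + l * r) ^+ 2 =
            l * (1 - l) * (dotp a u0 - r) ^+ 2 + l * (1 - l) * t ^+ 2 * gram a b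
            + l * (k t - r ^+ 2) by rewrite /k; ring.
  have ll := mulr_ge0 l0 l1'; rewrite rE subrr mulr0 addr0 addr_ge0//.
    exact/mulr_ge0/sqr_ge0.
  by rewrite mulr_ge0// mulr_ge0// sqr_ge0.
exists f; split=> //.
- have ck : continuous k.
    move=> t; rewrite /k; apply: cvgD; [apply: cvgD|].
    + by apply: cvgMr_tmp; apply: cvgB; [exact: cvg_cst|exact: cvg_id].
    + by apply: cvgMr_tmp; exact: cvg_id.
    + apply: cvgMr_tmp; apply: cvgM; first exact: cvg_id.
      by apply: cvgB; [exact: cvg_cst|exact: cvg_id].
  move=> t; apply: cvgMr_tmp; apply: cvgB.
    by apply: cvgD; [exact: cvg_cst|apply: cvgMr_tmp; exact: cvg_id].
  by apply: (@continuous_comp _ _ _ k Num.sqrt); [exact: ck|exact: sqrt_continuous].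
- move=> s t; rewrite !in_itv/= => /andP[s0 s1] /andP[t0 t1] st.
  have [t_0|tN0] := eqVneq t 0.
    by have -> : s = t by apply/eqP; rewrite eq_le st t_0 s0.
  have tp : 0 < t by rewrite lt_def tN0.
  have l01 : 0 <= s / t <= 1 by rewrite divr_ge0//= ler_pdivrMr// mul1r.
  have t01 : 0 <= t <= 1 by rewrite t0.
  have := f_conv _ _ l01 t01; rewrite divfK// => /le_trans; apply.
  by rewrite ler_piMl ?f_ge0//; case/andP: l01.
- move=> t t01; set w := u0 + t *: b.
  have aw : dotp a (w - f t *: a) = Num.sqrt (k t).
    by rewrite /w !dotpE /f divfK//; ring.
  (* Shifting by [f t *: a] preserves [gram a w], which is $|a|^2 - k(t)$; the product with [a] has
     become $\sqrt{k(t)}$, so the squared norm is 1. *)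
  have := gram_shift (f t) a w; rewrite {1}/gram aw sqr_sqrtr ?k0// -kE -/w => h.
  by apply: (mulfI xN0); rewrite mulr1; lra.
Qed.

Lemma continuous_segment {R : realType} {d} (P v : 'rV[R]_d) (f : R -> R) :
  continuous f -> continuous (fun t => P + f t *: v).
Proof.
move=> cf t; apply: cvgD; first exact: cvg_cst.
by apply: cvgZr_tmp; exact: cf.
Qed.

Lemma shortest_motion_exists {R : realType} {d} (A0 B0 A1 B1 : 'rV[R]_d) :
    eucl_dist A0 B0 = 1 -> eucl_dist A1 B1 = 1 ->
    0 <= dotp (A1 - A0) (B0 - A0) -> 0 <= dotp (A1 - A0) (B1 - A1) ->
    0 <= dotp (B1 - B0) (B0 - A0) -> 0 <= dotp (B1 - B0) (B1 - A1) ->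
  exists A B : R -> 'rV[R]_d, rigid_motion A0 B0 A1 B1 A B /\
    total_length A B = (eucl_dist A0 A1 + eucl_dist B0 B1)%:E.
Proof.
move=> /eucl_norm_eq1 u0 /eucl_norm_eq1 u1 p0 p1 q0 q1.
set a := A1 - A0; set b := B1 - B0.
have u1E : B1 - A1 = B0 - A0 + b - a.
  by rewrite /a /b; apply/rowP => i; rewrite !mxE; ring.
suff [f [cf ndf f0 f1 fu]] : exists f : R -> R, [/\ continuous f,
    {in `[0, 1] &, {homo f : x y / x <= y}}, f 0 = 0, f 1 = 1 &
    forall t, 0 <= t <= 1 ->
      dotp (B0 - A0 + t *: b - f t *: a) (B0 - A0 + t *: b - f t *: a) = 1].
  exists (fun t => A0 + f t *: a), (fun t => B0 + t *: b); split.
    split.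
    - by apply: continuous_subspaceT; exact: continuous_segment.
    - apply: continuous_subspaceT; apply: (@continuous_segment _ _ _ _ id).
      by move=> t; exact: cvg_id.
    - by rewrite f0 scale0r addr0.
    - by rewrite scale0r addr0.
    - by rewrite f1 scale1r addrC subrK.
    - by rewrite scale1r addrC subrK.
    - move=> t t01; apply/eucl_norm_eq1; rewrite -[RHS](fu t t01).
      by rewrite opprD addrACA addrA.
  rewrite /total_length (curve_length_segment _ _ _ ndf f0 f1).
  by rewrite (@curve_length_segment _ _ B0 b id).
have [a0|aN0] := eqVneq a 0; last exact: (monotone_parameter _ _ _ _ u0 u1 u1E).
(* When [a = 0], the nonnegative products of [b] with the two unit vectors sum to 0, so both vanish;
   their difference is $|b|^2$. Neither endpoint moves. *)
have b0 : b = 0.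
  have := sum_dotp_ends _ _ _ _ u0 u1 u1E.
  rewrite a0 !dotp0l addr0 => /esym q.
  have bq0 : dotp b (B0 - A0) = 0 by rewrite /b in q *; lra.
  have : dotp b (B1 - A1) = 0 by rewrite /b in q bq0 *; lra.
  rewrite u1E a0 subr0 dotpDr bq0 add0r => /eqP.
  by rewrite dotp_eq0 => /eqP.
exists id; split=> //; first by move=> t; exact: cvg_id.
by move=> t _; rewrite a0 b0 !scaler0 subr0 addr0.
Qed.

(** The two pairs have equal sums, and two numbers with nonnegative product both take the weak sign
    of their sum. *)
Lemma dotp_ends_same_sign {R : realType} {d} (a b u0 u1 : 'rV[R]_d) :
    dotp u0 u0 = 1 -> dotp u1 u1 = 1 -> u1 = u0 + b - a ->
    0 <= dotp a u0 * dotp a u1 -> 0 <= dotp b u0 * dotp b u1 ->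
  [/\ 0 <= dotp a u0, 0 <= dotp a u1, 0 <= dotp b u0 & 0 <= dotp b u1] \/
  [/\ dotp a u0 <= 0, dotp a u1 <= 0, dotp b u0 <= 0 & dotp b u1 <= 0].
Proof.
move=> u0u0 u1u1 u1E; have := sum_dotp_ends _ _ _ _ u0u0 u1u1 u1E.
move: (dotp a u0) (dotp a u1) (dotp b u0) (dotp b u1) => p0 p1 q0 q1 pq p q.
have [s0|s0] := lerP 0 (p0 + p1); [left|right]; split; nra.
Qed.

Theorem theorem1 (R : realType) (d : nat) (hd : (2 <= d)%N)
    (A0 B0 A1 B1 : 'rV[R]_d)
    (h0 : eucl_dist A0 B0 = 1) (h1 : eucl_dist A1 B1 = 1) :
  (exists A B : R -> 'rV[R]_d,
      rigid_motion A0 B0 A1 B1 A B /\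
      total_length A B = (eucl_dist A0 A1 + eucl_dist B0 B1)%:E)
  <->
  (0 <= dotp (A1 - A0) (B0 - A0) * dotp (A1 - A0) (B1 - A1) /\
   0 <= dotp (B1 - B0) (B0 - A0) * dotp (B1 - B0) (B1 - A1)).
Proof.
split=> [[A [B [[cA cB A0E B0E A1E B1E AB] L]]]|[pp qq]].
  have gA := curve_length_ge A; have gB := curve_length_ge B.
  have [lA lB] : (curve_length 0 1 A <= (eucl_dist (A 0%R) (A 1%R))%:E)%E /\
                 (curve_length 0 1 B <= (eucl_dist (B 0%R) (B 1%R))%:E)%E.
    (* A finite sum forces both lengths to be finite; neither is below its chord, so neither can
       exceed it. *)
    move: L gA gB; rewrite /total_length A0E B0E A1E B1E.
    case: (curve_length 0 1 A) => [l| |]//; case: (curve_length 0 1 B) => [m| |]//.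
    by move=> [lm]; rewrite !lee_fin; split; lra.
  have cu : {within `[0, 1], continuous (fun t => B t - A t)}.
    by move=> t; apply: cvgB; [exact: cB|exact: cA].
  have uu t : 0 <= t <= 1 -> dotp (B t - A t) (B t - A t) = 1.
    by move=> t01; apply/eucl_norm_eq1; exact: AB.
  have segAB t : 0 <= t <= 1 -> exists s r, [/\ 0 <= s <= 1, 0 <= r <= 1 &
      B t - A t = B 0 - A 0 + r *: (B 1 - B 0) - s *: (A 1 - A 0)].
    move=> t01; have [s s01 ->] := shortest_curve_segment _ _ lA t01.
    have [r r01 ->] := shortest_curve_segment _ _ lB t01.
    by exists s, r; split=> //; rewrite opprD addrACA addrA.
  rewrite -A0E -B0E -A1E -B1E; split.
    apply: (@dotp_ends_ge0 _ _ _ (B 1 - B 0) (fun t => B t - A t)) => //.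
      by apply/rowP => i; rewrite !mxE; ring.
    by move=> t /segAB[s [r [s01 r01 ->]]]; exists s; exists r.
  (* Exchanging A and B negates the unit vector, hence both factors, and keeps the product. *)
  rewrite -mulrNN -!dotpNr !opprB.
  apply: (@dotp_ends_ge0 _ _ _ (A 1 - A 0) (fun t => A t - B t)) => //.
  - by move=> t; apply: cvgB; [exact: cA|exact: cB].
  - by apply/rowP => i; rewrite !mxE; ring.
  - by move=> t /uu; rewrite -opprB dotpNl dotpNr opprK.
  - move=> t /segAB[s [r [s01 r01 e]]]; exists r; exists s => //.
    by rewrite -opprB e; apply/rowP => i; rewrite !mxE; ring.
have u1E : B1 - A1 = B0 - A0 + (B1 - B0) - (A1 - A0).
  by apply/rowP => i; rewrite !mxE; ring.
have /eucl_norm_eq1 u0 := h0; have /eucl_norm_eq1 u1 := h1.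
have [[p0 p1 q0 q1]|[p0 p1 q0 q1]] := dotp_ends_same_sign _ _ _ _ u0 u1 u1E pp qq.
  exact: shortest_motion_exists.
(* All four products are nonpositive here; exchanging the endpoints makes them nonnegative. *)
have [||||||B [A [[cB cA B0E A0E B1E A1E BA] L]]] :=
    @shortest_motion_exists _ _ B0 A0 B1 A1.
- by rewrite eucl_distC.
- by rewrite eucl_distC.
- by rewrite -oppr_le0 -dotpNr opprB.
- by rewrite -oppr_le0 -dotpNr opprB.
- by rewrite -oppr_le0 -dotpNr opprB.
- by rewrite -oppr_le0 -dotpNr opprB.
exists A, B; split; last by rewrite addrC -L; exact: addeC.
by split=> // t t01; rewrite eucl_distC BA.
Qed.
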